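(* Let $2<\alpha<3$, $0<\varepsilon\le\frac12$, and let $\gamma\in C^\infty(\mathbb R/\mathbb Z,\mathbb R^n)$ be a simple closed curve parametrized by arc length. There is an analytic function $G_1^\alpha:(\mathbb R^n\setminus\{0,1\})\times\mathbb R^{4n}\to\mathbb R^n$ (independent of $\gamma$ and $\varepsilon$), such that for all $x\in\mathbb R/\mathbb Z$, $$(P^\perp_{\dot\gamma}R_1^{\alpha,\varepsilon}\gamma)(x)=\int_{|w|\in[\varepsilon,\frac12]}\iiiint_{[0,1]^4}(r_1-r_2)^2\,G_1^\alpha\Big(\int_0^1\dot\gamma(x+sw)\,\mathrm ds,\ \dot\gamma(x),\ \ddot\gamma(x+r_2w+(r_1-r_2)\psi_1w),\ \ddot\gamma(x+r_2w+(r_1-r_2)\psi_2w),\ \int_0^1\ddot\gamma(x+tw)(1-t)\,\mathrm dt\Big)\,\mathrm d\psi_1\,\mathrm d\psi_2\,\mathrm dr_1\,\mathrm dr_2\,\frac{\mathrm dw}{|w|^{\alpha-2}}.$$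
   Context: $(R_1^{\alpha,\varepsilon}\gamma)(x)=\int_{|w|\in[\varepsilon,\frac12]}(\gamma(x+w)-\gamma(x)-w\dot\gamma(x))\Big(\frac{1}{|\gamma(x+w)-\gamma(x)|^{\alpha+2}}-\frac{1}{|w|^{\alpha+2}}\Big)\mathrm dw$. For $v\in\mathbb R^n$, $P^\perp_{\dot\gamma(x)}v=v-\langle v,\dot\gamma(x)\rangle\dot\gamma(x)$ and $(P^\perp_{\dot\gamma}u)(x)=P^\perp_{\dot\gamma(x)}u(x)$. Here ''$\mathbb R^n\setminus\{0,1\}$'' means the first argument $a$ avoids $|a|\in\{0,1\}$ (the function involves $g(a)=\frac{1}{2|a|^{\alpha+2}}\frac{1-|a|^{\alpha+2}}{1-|a|^2}$). *)

(* Defs.v *)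
From mathcomp Require Import all_boot.
From Stdlib Require Import Reals ClassicalEpsilon.

Set Implicit Arguments.
Unset Strict Implicit.
Unset Printing Implicit Defensive.

Local Open Scope R_scope.

Definition vec (n : nat) := 'I_n -> R.

Definition Rsum {I : finType} (F : I -> R) : R := \big[Rplus/0%R]_(i : I) F i.
Definition Rprod {I : finType} (F : I -> R) : R := \big[Rmult/1%R]_(i : I) F i.
Definition Rsupdist {I : finType} (y p : I -> R) : R :=
  \big[Rmax/0%R]_(i : I) Rabs (y i - p i).

Definition dotv {n : nat} (u v : vec n) : R := Rsum (fun i => u i * v i).
Definition normv {n : nat} (u : vec n) : R := sqrt (dotv u u).
Definition subv {n : nat} (u v : vec n) : vec n := fun i => u i - v i.

Definition perp {n : nat} (t v : vec n) : vec n := fun i => v i - dotv v t * t i.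

(** Riemann integral of a real function on [a,b] (value of the Stdlib
    Riemann integral whenever f is Riemann integrable on [a,b]). *)
Definition Rint (f : R -> R) (a b : R) : R :=
  epsilon (inhabits 0%R)
    (fun v => exists pr : Riemann_integrable f a b, RiemannInt pr = v).

Definition Vint {n : nat} (f : R -> vec n) (a b : R) : vec n :=
  fun i => Rint (fun t => f t i) a b.

Definition Wint {n : nat} (f : R -> vec n) (eps : R) : vec n :=
  fun i => Rint (fun w => f w i) (- (1/2)) (- eps) + Rint (fun w => f w i) eps (1/2).

(** Real analyticity of f : R^I -> R^J on a (open) domain D: around every
    point of D, f is given on a neighbourhood (contained in D) by an
    absolutely convergent multivariate power series sum_al c_al (y-p)^al.
    Absolute convergence = bounded finite partial sums of |terms|; the sum is
    then the limit of the box partial sums over al in {0..N}^I. *)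
Definition box_partial {I : finType} (N : nat) (F : (I -> nat) -> R) : R :=
  Rsum (fun a : {ffun I -> 'I_N.+1} => F (fun i => nat_of_ord (a i))).

Definition monomial {I : finType} (y p : I -> R) (al : I -> nat) : R :=
  Rprod (fun i => pow (y i - p i) (al i)).

Definition real_analytic_on {I J : finType} (D : (I -> R) -> Prop)
  (f : (I -> R) -> (J -> R)) : Prop :=
  forall p, D p ->
    exists r, 0 < r /\
    exists c : (I -> nat) -> J -> R,
      forall y, Rsupdist y p < r ->
        D y /\
        forall j,
          Un_cv (fun N => box_partial N (fun al => c al j * monomial y p al)) (f y j) /\
          exists M, forall N,
            box_partial N (fun al => Rabs (c al j * monomial y p al)) <= M.

Definition blk {n : nat} (u : ('I_5 * 'I_n) -> R) (k : nat) : vec n :=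
  fun i => u (@inord 4 k, i).

Definition uncurry5 {n : nat} (G : vec n -> vec n -> vec n -> vec n -> vec n -> vec n)
  : (('I_5 * 'I_n) -> R) -> vec n :=
  fun u => G (blk u 0) (blk u 1) (blk u 2) (blk u 3) (blk u 4).

Definition dom5 {n : nat} (u : ('I_5 * 'I_n) -> R) : Prop :=
  normv (blk u 0) <> 0 /\ normv (blk u 0) <> 1.

Definition analytic5 {n : nat} (G : vec n -> vec n -> vec n -> vec n -> vec n -> vec n) : Prop :=
  real_analytic_on (@dom5 n) (uncurry5 G).

Definition smooth_closed_curve {n : nat} (g : R -> vec n) (Dg : nat -> R -> vec n) : Prop :=
  Dg 0%nat = g /\
  (forall k t i, derivable_pt_lim (fun s => Dg k s i) t (Dg (S k) t i)) /\
  (forall t, g (t + 1) = g t).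

Definition simple_curve {n : nat} (g : R -> vec n) : Prop :=
  forall s t, g s = g t -> exists k : Z, t - s = IZR k.

Definition arclength_param {n : nat} (Dg : nat -> R -> vec n) : Prop :=
  forall t, normv (Dg 1%nat t) = 1.

(** R_1^{alpha,eps} gamma (x), with g1 = gamma'. *)
Definition R1op {n : nat} (alpha eps : R) (g g1 : R -> vec n) (x : R) : vec n :=
  Wint (fun w i =>
          (g (x + w) i - g x i - w * g1 x i) *
          (/ Rpower (normv (subv (g (x + w)) (g x))) (alpha + 2)
           - / Rpower (Rabs w) (alpha + 2))) eps.

Definition RHS62 {n : nat} (G : vec n -> vec n -> vec n -> vec n -> vec n -> vec n)
  (alpha eps : R) (g1 g2 : R -> vec n) (x : R) : vec n :=
  Wint (fun w i =>
    Vint (fun r2 =>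
      Vint (fun r1 =>
        Vint (fun psi2 =>
          Vint (fun psi1 => fun j =>
            (r1 - r2) ^ 2 *
            G (Vint (fun s => g1 (x + s * w)) 0 1)
              (g1 x)
              (g2 (x + r2 * w + (r1 - r2) * psi1 * w))
              (g2 (x + r2 * w + (r1 - r2) * psi2 * w))
              (Vint (fun t j' => g2 (x + t * w) j' * (1 - t)) 0 1) j)
          0 1) 0 1) 0 1) 0 1 i
    / Rpower (Rabs w) (alpha - 2)) eps.

(* Main.v *)
(** Write [g(x+w) - g(x) = w a] and [g(x+w) - g(x) - w g'(x) = w^2 e] with
    [a = int_0^1 g'(x+sw) ds] and [e = int_0^1 (1-t) g''(x+tw) dt].  The kernel
    difference is then [|w|^(-alpha-2) (|a|^(-alpha-2) - 1)], which vanishes at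
    [|a| = 1].  As [|g'| = 1], the quantity [1 - |a|^2] is half the double average of
    [|g'(x + r1 w) - g'(x + r2 w)|^2], and each increment of [g'] is the average of
    [g''] times [(r1-r2) w]; this produces the factor [w^2 (r1-r2)^2 <c, d>].  Hence
    [G(a,b,c,d,e) = (|a|^(-alpha-2) - 1)/(2(1 - |a|^2)) <c,d> (e - <e,b> b)].

    [G] is a power series in the polynomial [|a|^2 - |a0|^2] times a polynomial.
    Its terms are polynomials whose norms, with the monomial of exponent [al]
    weighted by [rho^|al|], are summable for small [rho], so their monomials may be
    regrouped into one multivariate series. *)

Require Import Defs.
From HB Require Import structures.
From mathcomp Require Import all_boot.
From Stdlib Require Import Reals Lra Lia ClassicalEpsilon FunctionalExtensionality.
From Coquelicot Require Import Coquelicot.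

Set Implicit Arguments.
Unset Strict Implicit.
Unset Printing Implicit Defensive.

Local Open Scope R_scope.

Local Arguments INR : simpl never.

(** * Power series in one variable *)

Definition expands_at (f : R -> R) (q : R) : Prop :=
  exists (a : nat -> R) (d : R),
    0 < d /\ forall s, Rabs s < d -> is_pseries a s (f (q + s)).

(** A point [t] strictly between [|s|] and [d] cannot lie outside the disk of convergence, since the
    terms of a convergent series tend to 0. The strict inequality gives absolute convergence at [s],
    which Cauchy products and weighted norms require. *)
Lemma pseries_disk_CV_radius (a : nat -> R) (f : R -> R) (d s : R) :
  (forall t, Rabs t < d -> is_pseries a t (f t)) ->
  Rabs s < d -> Rbar_lt (Rabs s) (CV_radius a).
Proof.
move=> ha hs.
set t := (Rabs s + d) / 2.
have [t_gt0 s_lt_t t_lt_d] : [/\ 0 < t, Rabs s < t & t < d].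
  by have := Rabs_pos s; rewrite /t; split; lra.
have t_le : Rbar_le t (CV_radius a).
  apply: Rbar_not_lt_le => lt_t.
  apply: (@CV_disk_outside a t); first by rewrite Rabs_pos_eq //; lra.
  apply: ex_series_lim_0; exists (f t); apply/is_pseries_R; apply: ha.
  by rewrite Rabs_pos_eq //; lra.
exact: (Rbar_lt_le_trans _ t).
Qed.

Lemma expands_at_mul (f g : R -> R) (q : R) :
  expands_at f q -> expands_at g q -> expands_at (fun x => f x * g x) q.
Proof.
move=> [a [d [d_gt0 ha]]] [b [d' [d'_gt0 hb]]].
exists (PS_mult a b), (Rmin d d'); split; first exact: Rmin_pos.
move=> s hs.
have [sd sd'] : Rabs s < d /\ Rabs s < d'.
  by have := Rmin_l d d'; have := Rmin_r d d'; lra.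
apply: is_pseries_mult; [exact: ha|exact: hb| |].
- exact: (pseries_disk_CV_radius ha).
- exact: (pseries_disk_CV_radius hb).
Qed.

Lemma expands_at_inv_sub (p q : R) : q <> p -> expands_at (fun x => / (p - x)) q.
Proof.
move=> qp; have pq0 : p - q <> 0 by lra.
(* Geometric series in [s / (p - q)]. *)
exists (fun k => / (p - q) * (/ (p - q)) ^ k), (Rabs (p - q)).
split; first exact: Rabs_pos_lt.
move=> s hs; apply/is_pseries_R.
have small : Rabs (s / (p - q)) < 1.
  by rewrite Rabs_div //; apply/Rlt_div_l; [exact: Rabs_pos_lt | lra].
have ne : p - (q + s) <> 0.
  move=> h; have hh : s = p - q by lra.
  by rewrite hh in hs; lra.
have := is_series_scal (/ (p - q)) _ _ (is_series_geom _ small).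
have -> : scal (/ (p - q)) (/ (1 - s / (p - q))) = / (p - (q + s)).
  rewrite /scal /= /mult /=; field; split=> //; lra.
apply: is_series_ext => k; rewrite /scal /= /mult /=.
by rewrite /Rdiv Rpow_mult_distr; ring.
Qed.

(** * The binomial series and real powers *)

Fixpoint gen_binomial (b : R) (k : nat) : R :=
  if k is k'.+1 then gen_binomial b k' * (b - INR k') / INR k'.+1 else 1.

Lemma gen_binomialS (b : R) (k : nat) :
  gen_binomial b k.+1 = gen_binomial b k * (b - INR k) / INR k.+1.
Proof. by []. Qed.

Lemma CV_radius_gen_binomial (b : R) : b < 0 -> CV_radius (gen_binomial b) = 1.
Proof.
move=> b0.
have ne k : gen_binomial b k <> 0.
  elim: k => [|k IH]; first by rewrite /=; lra.
  have k0 : INR k.+1 <> 0 by apply: not_0_INR.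
  have bk : b - INR k <> 0 by have := pos_INR k; lra.
  rewrite gen_binomialS.
  apply: Rmult_integral_contrapositive_currified; last exact: Rinv_neq_0_compat.
  exact: Rmult_integral_contrapositive_currified.
rewrite (CV_radius_finite_DAlembert _ 1 ne) ?Rinv_1 //; first lra.
(* For [b < 0] no coefficient vanishes, and consecutive ones have ratio [(k - b) / (k + 1)] in
   absolute value, which tends to 1. *)
apply: (is_lim_seq_ext (fun k => 1 + (- b - 1) * / INR k.+1)).
  move=> k; have k0 : 0 < INR k.+1 by apply: lt_0_INR; lia.
  have -> : gen_binomial b k.+1 / gen_binomial b k = - ((INR k - b) / INR k.+1).
    have nek := ne k.
    by rewrite gen_binomialS; field; split=> //; lra.
  rewrite Rabs_Ropp Rabs_pos_eq; first by rewrite S_INR in k0 *; field; lra.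
  by apply: Rdiv_le_0_compat => //; have := pos_INR k; lra.
have -> : Finite 1 = Finite (1 + (- b - 1) * 0) by congr Finite; ring.
apply: is_lim_seq_plus'; first exact: is_lim_seq_const.
apply: is_lim_seq_mult'; first exact: is_lim_seq_const.
apply/(is_lim_seq_incr_1 (fun k => / INR k)).
have -> : Finite 0 = Rbar_inv p_infty by [].
by apply: is_lim_seq_inv; first exact: is_lim_seq_INR.
Qed.

(** The sum [y] of the series solves [(1 + t) y' = b y], so [y (1 + t)^(-b)] has zero derivative on
    the unit interval and keeps its value 1 at 0. *)
Lemma binomial_series (b s : R) :
  b < 0 -> Rabs s < 1 -> is_pseries (gen_binomial b) s (Rpower (1 + s) b).
Proof.
move=> b0 hs; set a := gen_binomial b.
have cv t : Rabs t < 1 -> Rbar_lt (Rabs t) (CV_radius a).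
  by rewrite /a CV_radius_gen_binomial.
have dcv t : Rabs t < 1 -> ex_pseries (PS_derive a) t.
  by move=> ht; apply: CV_radius_inside; rewrite CV_radius_derive; apply: cv.
(* In coefficients this is [(k + 1) a_(k+1) + k a_k = b a_k], the recursion that defines
   [gen_binomial]. *)
have ode t : Rabs t < 1 -> (1 + t) * PSeries (PS_derive a) t = b * PSeries a t.
  move=> ht; rewrite Rmult_plus_distr_r Rmult_1_l -PSeries_incr_1.
  rewrite -PSeries_plus; [|exact: dcv|exact/ex_pseries_incr_1/dcv].
  rewrite -PSeries_scal; apply: PSeries_ext => k.
  rewrite /PS_plus /PS_scal /PS_incr_1 /PS_derive /plus /scal /= /mult /=.
  case: k => [|k]; first by rewrite /zero /a /= /INR; field.
  have k0 : INR k.+2 <> 0 by apply: not_0_INR.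
  by rewrite /a (gen_binomialS b k.+1); field.
have prod_const t : Rabs t < 1 -> PSeries a t * Rpower (1 + t) (- b) = 1.
  pose f t := PSeries a t * Rpower (1 + t) (- b).
  have f0 : f 0 = 1.
    rewrite /f PSeries_0 Rplus_0_r /Rpower ln_1 Rmult_0_r exp_0.
    by rewrite /a /= Rmult_1_l.
  have df u : Rabs u < 1 -> is_derive f u 0.
    move=> hu; have u1 : 0 < 1 + u by move: hu => /Rabs_def2; lra.
    have dP : is_derive (fun v => Rpower (1 + v) (- b)) u
                 (- b / (1 + u) * Rpower (1 + u) (- b)).
      rewrite /Rpower; auto_derive => //; field; lra.
    have := is_derive_mult _ _ u _ _ (is_derive_PSeries a u (cv u hu)) dP Rmult_comm.
    rewrite /plus /mult /=.
    have -> // : PSeries (PS_derive a) u * Rpower (1 + u) (- b) +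
       PSeries a u * (- b / (1 + u) * Rpower (1 + u) (- b)) = 0.
    have -> : PSeries (PS_derive a) u = b * PSeries a u / (1 + u).
      by rewrite -ode //; field; lra.
    by field; lra.
  move=> ht; rewrite -/(f t) -f0.
  have [t0|[->//|t0]] := Rtotal_order t 0.
    apply: eq_is_derive => // u hu; apply: df.
    by apply: Rabs_def1; move: ht => /Rabs_def2; lra.
  symmetry; apply: eq_is_derive => // u hu; apply: df.
  by apply: Rabs_def1; move: ht => /Rabs_def2; lra.
have -> : Rpower (1 + s) b = PSeries a s.
  have h : Rpower (1 + s) (- b) * Rpower (1 + s) b = 1.
    rewrite -Rpower_plus Rplus_opp_l Rpower_O //.
    by move: hs => /Rabs_def2; lra.
  apply: (Rmult_eq_reg_l (Rpower (1 + s) (- b))).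
    by rewrite h Rmult_comm prod_const.
  by apply: Rgt_not_eq; apply: exp_pos.
exact/PSeries_correct/CV_radius_inside/cv.
Qed.

(** Scaling reduces to the binomial series: [(q + s)^b = q^b (1 + s / q)^b] for [|s| < q]. *)
Lemma expands_at_Rpower (b q : R) : b < 0 -> 0 < q -> expands_at (fun x => Rpower x b) q.
Proof.
move=> b0 q0; exists (fun k => Rpower q b * (gen_binomial b k * (/ q) ^ k)), q.
split=> // s hs; apply/is_pseries_R.
have sq : Rabs (s / q) < 1.
  rewrite Rabs_div; last lra.
  by rewrite (Rabs_pos_eq q); [apply/Rlt_div_l; lra | lra].
have -> : q + s = q * (1 + s / q) by field; lra.
rewrite -Rpower_mult_distr //; last by move: sq => /Rabs_def2; lra.
have := is_series_scal (Rpower q b) _ _ (proj1 (is_pseries_R _ _ _) (binomial_series b0 sq)).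
apply: is_series_ext => k; rewrite /scal /= /mult /=.
by rewrite /Rdiv Rpow_mult_distr; ring.
Qed.

Lemma is_series_zero : is_series (fun=> 0) 0.
Proof.
apply/is_series_Reals => e e0; exists 0%nat => k _.
by rewrite /R_dist sum_eq_R0 // Rminus_diag Rabs_R0.
Qed.

Lemma expands_at_sub_const (f : R -> R) (c q : R) :
  expands_at f q -> expands_at (fun x => f x - c) q.
Proof.
move=> [a [d [d0 ha]]].
exists (fun k => a k - (if k is 0%nat then c else 0)), d; split=> // s hs.
apply/is_pseries_R.
have hc : is_series (fun k => (if k is 0%nat then c else 0) * s ^ k) c.
  apply: (is_series_decr_1 _ c).
  rewrite pow_O Rmult_1_r plus_opp_r.
  by apply: is_series_ext is_series_zero => k; symmetry; exact: Rmult_0_l.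
have := is_series_minus _ _ _ _ (proj1 (is_pseries_R _ _ _) (ha s hs)) hc.
by apply: is_series_ext => k; rewrite /plus /opp /=; ring.
Qed.

(** * Series of polynomials in several variables *)

HB.instance Definition _ := Monoid.isComLaw.Build R 0 Rplus
  (fun x y z => esym (Rplus_assoc x y z)) Rplus_comm Rplus_0_l.
HB.instance Definition _ := Monoid.isComLaw.Build R 1 Rmult
  (fun x y z => esym (Rmult_assoc x y z)) Rmult_comm Rmult_1_l.
HB.instance Definition _ := Monoid.isMulLaw.Build R 0 Rmult Rmult_0_l Rmult_0_r.
HB.instance Definition _ := Monoid.isAddLaw.Build R Rmult Rplus
  Rmult_plus_distr_r Rmult_plus_distr_l.

Lemma Rabs_bigsum_le (T : Type) (s : seq T) (P : pred T) (F G : T -> R) :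
  (forall t, P t -> Rabs (F t) <= G t) ->
  Rabs (\big[Rplus/0]_(t <- s | P t) F t) <= \big[Rplus/0]_(t <- s | P t) G t.
Proof.
move=> FG; apply: (big_ind2 (fun x y => Rabs x <= y)) => //.
- by rewrite Rabs_R0; apply: Rle_refl.
- by move=> x1 x2 y1 y2 h1 h2; apply: Rle_trans (Rabs_triang _ _) _; lra.
Qed.

Lemma bigsum_le (T : Type) (s : seq T) (P : pred T) (F G : T -> R) :
  (forall t, P t -> F t <= G t) ->
  \big[Rplus/0]_(t <- s | P t) F t <= \big[Rplus/0]_(t <- s | P t) G t.
Proof.
move=> FG; apply: (big_ind2 Rle) => //; first exact: Rle_refl.
by move=> *; apply: Rplus_le_compat.
Qed.

Lemma bigsum_ge0 (T : Type) (s : seq T) (P : pred T) (F : T -> R) :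
  (forall t, P t -> 0 <= F t) -> 0 <= \big[Rplus/0]_(t <- s | P t) F t.
Proof.
move=> F0; apply: (big_ind (fun x => 0 <= x)) => //; first exact: Rle_refl.
by move=> *; apply: Rplus_le_le_0_compat.
Qed.

Lemma bigsum_sub_le (T : Type) (s : seq T) (P : pred T) (F : T -> R) :
  (forall t, 0 <= F t) ->
  \big[Rplus/0]_(t <- s | P t) F t <= \big[Rplus/0]_(t <- s) F t.
Proof.
move=> F0; rewrite big_mkcond; apply: bigsum_le => t _.
by case: ifP => _ //; apply: Rle_refl.
Qed.

Lemma is_series_bigsum (T : Type) (s : seq T) (F : T -> nat -> R) (l : T -> R) :
  (forall t, is_series (F t) (l t)) ->
  is_series (fun k => \big[Rplus/0]_(t <- s) F t k) (\big[Rplus/0]_(t <- s) l t).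
Proof.
move=> hF; elim: s => [|t s IH].
  by rewrite big_nil; apply: is_series_ext is_series_zero => k; rewrite big_nil.
rewrite big_cons.
apply: (is_series_ext (fun k => plus (F t k) (\big[Rplus/0]_(u <- s) F u k))).
  by move=> k; rewrite big_cons.
exact: (is_series_plus _ _ _ _ (hF t) IH).
Qed.

(* Tannery's theorem, for dominated rows that are eventually stationary. *)
Lemma series_dominated_cv (F : nat -> nat -> R) (g b : nat -> R) (s : nat -> R) (l : R) :
  (forall N k, Rabs (F N k) <= b k) -> (forall k, Rabs (g k) <= b k) -> ex_series b ->
  (forall k, exists N0, forall N, (N0 <= N)%nat -> F N k = g k) ->
  (forall N, is_series (F N) (s N)) -> is_series g l -> Un_cv s l.
Proof.
move=> Fb gb exb stat Fs gl e e_gt0.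
have /is_lim_seq_Reals b_cv : is_lim_seq (sum_f_R0 b) (Series b).
  apply: (is_lim_seq_ext (sum_n b)); first by move=> k; exact: sum_n_Reals.
  exact: (Series_correct _ exb).
(* Beyond [K] the dominating series has a tail below [e / 2]. *)
have [K hK] := b_cv (e / 2) ltac:(lra).
(* Only finitely many columns [k <= K] remain, so one [N1] makes all of them stationary. *)
have [N1 hN1] : exists N1, forall N k, (N1 <= N)%nat -> (k <= K)%nat -> F N k = g k.
  elim: (K) => [|K' [N1 IH]].
    by have [N0 h] := stat 0%nat; exists N0 => N k hN; rewrite leqn0 => /eqP->; apply: h.
  have [N0 h] := stat K'.+1; exists (maxn N0 N1) => N k.
  rewrite geq_max => /andP[h0 h1]; rewrite leq_eqVlt => /orP[/eqP->|hk]; first exact: h.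
  exact: IH.
exists N1 => N /leP hN; rewrite /R_dist.
(* The difference vanishes up to [K] and is at most [2 * b k] afterwards, so its sum is below
   [e]. *)
pose d k := F N k - g k.
have dl : is_series d (s N - l) by apply: (is_series_minus _ _ _ _ (Fs N) gl).
have db k : Rabs (d k) <= 2 * b k.
  rewrite /d; have := Rabs_triang (F N k) (- g k); rewrite Rabs_Ropp.
  by have := Fb N k; have := gb k; rewrite /Rminus; lra.
rewrite -(is_series_unique _ _ dl) (Series_incr_n d K.+1); last by exists (s N - l).
  rewrite [sum_f_R0 _ _](_ : _ = 0) ?Rplus_0_l; last first.
    rewrite -pred_Sn (sum_eq _ (fun=> 0)); first by rewrite sum_cte; ring.
    by move=> k /leP hk; rewrite /d (hN1 N k hN hk); ring.
  have exb2 : ex_series (fun k => 2 * b (K.+1 + k)%coq_nat).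
    apply: (ex_series_scal 2); exact/(ex_series_incr_n b K.+1).
  have exd : ex_series (fun k => Rabs (d (K.+1 + k)%coq_nat)).
    apply: ex_series_le exb2 => k; rewrite /norm /= /abs /= Rabs_Rabsolu; exact: db.
  apply: Rle_lt_trans (Series_Rabs _ exd) _.
  apply: Rle_lt_trans (Series_le _ _ _ exb2) _.
    by move=> k; split; [exact: Rabs_pos | exact: db].
  rewrite Series_scal_l.
  have := hK K (le_n K); rewrite /R_dist (Series_incr_n b K.+1) //; last by lia.
  rewrite -pred_Sn => /Rabs_def2; lra.
lia.
Qed.

(** * Polynomials as lists of monomials, and their weighted norms *)

Section Polynomials.
Variable I : finType.
Implicit Types (y p : I -> R) (al : {ffun I -> nat}) (P Q : seq (R * {ffun I -> nat})).

(** A polynomial in [y - p] is a finite list of coefficients paired with exponents. Repeated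
    exponents are allowed, so sums and products need no collecting; exponents are finite functions
    so that they can be compared in [ffcoef]. *)
Definition ffeval p P y : R := \big[Rplus/0]_(t <- P) (t.1 * monomial y p t.2).

Definition ffweight (rho : R) (al : I -> nat) : R := Rprod (fun i => rho ^ al i).

(** Weighted l1 norm on the polydisk of radius [rho]. It depends on the list, not only on the
    polynomial, because like terms are not merged. *)
Definition ffnorm rho P : R := \big[Rplus/0]_(t <- P) (Rabs t.1 * ffweight rho t.2).

Definition ffcoef P al : R := \big[Rplus/0]_(t <- P | t.2 == al) t.1.

Definition ffmul P Q : seq (R * {ffun I -> nat}) :=
  [seq (s.1 * t.1, [ffun i => ((s.2 : {ffun I -> nat}) i + (t.2 : {ffun I -> nat}) i)%nat])
    | s <- P, t <- Q].

Lemma Rsupdist_coord y p i : Rabs (y i - p i) <= Rsupdist y p.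
Proof.
rewrite /Rsupdist -big_filter.
have : i \in [seq i <- index_enum I | true] by rewrite mem_filter mem_index_enum.
elim: [seq _ <- _ | _] => // j s IH; rewrite in_cons big_cons => /orP[/eqP<-|/IH h].
  exact: Rmax_l.
by apply: Rle_trans h (Rmax_r _ _).
Qed.

Lemma ffweight_gt0 rho (al : I -> nat) : 0 < rho -> 0 < ffweight rho al.
Proof.
move=> r0; rewrite /ffweight /Rprod; apply: (big_ind (fun x => 0 < x)); first lra.
  by move=> *; apply: Rmult_lt_0_compat.
by move=> i _; apply: pow_lt.
Qed.

Lemma monomial_le_weight y p rho (al : I -> nat) :
  Rsupdist y p < rho -> Rabs (monomial y p al) <= ffweight rho al.
Proof.
move=> yp; rewrite /monomial /ffweight /Rprod.
apply: (big_ind2 (fun x z => Rabs x <= z)).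
- by rewrite Rabs_R1; apply: Rle_refl.
- move=> x1 x2 y1 y2 h1 h2; rewrite Rabs_mult.
  by apply: Rmult_le_compat => //; exact: Rabs_pos.
- move=> i _; rewrite -RPow_abs; apply: pow_incr; split; first exact: Rabs_pos.
  by have := Rsupdist_coord y p i; lra.
Qed.

Lemma ffeval_mul p P Q y : ffeval p (ffmul P Q) y = ffeval p P y * ffeval p Q y.
Proof.
rewrite /ffeval /ffmul big_allpairs_dep /= big_distrlr /=.
apply: eq_bigr => s _; apply: eq_bigr => t _.
have -> : monomial y p [ffun i => (s.2 i + t.2 i)%nat] = monomial y p s.2 * monomial y p t.2.
  rewrite /monomial /Rprod -big_split /=; apply: eq_bigr => i _.
  by rewrite ffunE pow_add.
ring.
Qed.

(** Equality holds, rather than mere submultiplicativity, because the product list merges no like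
    terms and thus allows no cancellation. *)
Lemma ffnorm_mul rho P Q : ffnorm rho (ffmul P Q) = ffnorm rho P * ffnorm rho Q.
Proof.
rewrite /ffnorm /ffmul big_allpairs_dep /= big_distrlr /=.
apply: eq_bigr => s _; apply: eq_bigr => t _.
have -> : ffweight rho [ffun i => (s.2 i + t.2 i)%nat] = ffweight rho s.2 * ffweight rho t.2.
  rewrite /ffweight /Rprod -big_split /=; apply: eq_bigr => i _.
  by rewrite ffunE pow_add.
rewrite Rabs_mult; ring.
Qed.

Lemma ffnorm_ge0 rho P : 0 < rho -> 0 <= ffnorm rho P.
Proof.
move=> r0; apply: bigsum_ge0 => t _.
by apply: Rmult_le_pos; [exact: Rabs_pos | apply/Rlt_le/ffweight_gt0].
Qed.

Lemma ffeval_le_norm rho p P y : Rsupdist y p < rho -> Rabs (ffeval p P y) <= ffnorm rho P.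
Proof.
move=> yp; apply: Rabs_bigsum_le => t _; rewrite Rabs_mult.
by apply: Rmult_le_compat_l; [exact: Rabs_pos | exact: monomial_le_weight].
Qed.

Definition ffconst (c : R) : seq (R * {ffun I -> nat}) := [:: (c, [ffun=> 0%nat])].

Lemma monomial0 y p : monomial y p [ffun=> 0%nat] = 1.
Proof. by rewrite /monomial /Rprod big1 // => i _; rewrite ffunE. Qed.

Lemma ffweight0 rho : ffweight rho [ffun=> 0%nat] = 1.
Proof. by rewrite /ffweight /Rprod big1 // => i _; rewrite ffunE. Qed.

Lemma ffeval_const p c y : ffeval p (ffconst c) y = c.
Proof. by rewrite /ffeval big_seq1 /= monomial0 Rmult_1_r. Qed.

Lemma ffnorm_const rho c : ffnorm rho (ffconst c) = Rabs c.
Proof. by rewrite /ffnorm big_seq1 /= ffweight0 Rmult_1_r. Qed.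

Definition ffpow P k := iter k (ffmul P) (ffconst 1).

Lemma ffeval_pow p P k y : ffeval p (ffpow P k) y = ffeval p P y ^ k.
Proof. by elim: k => [|k IH]; rewrite ?ffeval_const //= ffeval_mul IH. Qed.

Lemma ffnorm_pow rho P k : ffnorm rho (ffpow P k) = ffnorm rho P ^ k.
Proof. by elim: k => [|k IH]; rewrite ?ffnorm_const ?Rabs_R1 //= ffnorm_mul IH. Qed.

Definition is_polyn p (f : (I -> R) -> R) : Prop := exists P, forall y, f y = ffeval p P y.

Lemma is_polyn_const p c : is_polyn p (fun=> c).
Proof. by exists (ffconst c) => y; rewrite ffeval_const. Qed.

Lemma is_polyn_coord p i : is_polyn p (fun y => y i).
Proof.
exists [:: (p i, [ffun=> 0%nat]); (1, [ffun j => nat_of_bool (j == i)])] => y.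
rewrite /ffeval big_cons big_seq1 /= monomial0 /monomial /Rprod (bigD1 i) //= big1.
  by rewrite ffunE eqxx /=; ring.
by move=> j /negbTE ji; rewrite ffunE ji.
Qed.

Lemma is_polyn_add p f g : is_polyn p f -> is_polyn p g -> is_polyn p (fun y => f y + g y).
Proof.
by move=> [P hP] [Q hQ]; exists (P ++ Q) => y; rewrite /ffeval big_cat /= hP hQ.
Qed.

Lemma is_polyn_mul p f g : is_polyn p f -> is_polyn p g -> is_polyn p (fun y => f y * g y).
Proof. by move=> [P hP] [Q hQ]; exists (ffmul P Q) => y; rewrite ffeval_mul hP hQ. Qed.

Lemma is_polyn_sub p f g : is_polyn p f -> is_polyn p g -> is_polyn p (fun y => f y - g y).
Proof.
move=> hf hg; have [P hP] := is_polyn_add hf (is_polyn_mul (is_polyn_const p (-1)) hg).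
by exists P => y; rewrite -hP; ring.
Qed.

Lemma is_polyn_Rsum (J : finType) p (F : J -> (I -> R) -> R) :
  (forall j, is_polyn p (F j)) -> is_polyn p (fun y => Rsum (fun j => F j y)).
Proof.
move=> hF; rewrite /Rsum; elim: (index_enum J) => [|j s [P IH]].
  by exists [::] => y; rewrite /ffeval !big_nil.
have [Q hQ] := hF j; exists (Q ++ P) => y.
by rewrite big_cons IH hQ /ffeval big_cat.
Qed.

Lemma ffun_neq0 al : al != [ffun=> 0%nat] -> exists i, al i != 0%nat.
Proof.
move=> al0; apply/existsP; apply: contraNT al0; rewrite negb_exists => /forallP h.
by apply/eqP/ffunP => i; rewrite ffunE; have := h i; rewrite negbK => /eqP.
Qed.

Lemma monomial_center p al : al != [ffun=> 0%nat] -> monomial p p al = 0.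
Proof.
move=> al0; have [i ali] := ffun_neq0 al0.
rewrite /monomial /Rprod (bigD1 i) //= Rminus_diag pow_i; first ring.
by apply/leP; rewrite lt0n.
Qed.

Lemma is_polyn_vanishing p f : is_polyn p f -> f p = 0 ->
  exists P, all (fun t => t.2 != [ffun=> 0%nat]) P /\ forall y, f y = ffeval p P y.
Proof.
move=> [P hP] fp; exists [seq t <- P | t.2 != [ffun=> 0%nat]]; split.
  exact: filter_all.
move=> y; rewrite hP /ffeval (bigID (fun t => t.2 == [ffun=> 0%nat])) /= big_filter.
suff -> : \big[Rplus/0]_(t <- P | t.2 == [ffun=> 0%nat]) (t.1 * monomial y p t.2) = f p.
  by rewrite fp Rplus_0_l.
rewrite hP /ffeval [RHS](bigID (fun t => t.2 == [ffun=> 0%nat])) /= [X in _ = _ + X]big1.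
  by rewrite Rplus_0_r; apply: eq_bigr => t /eqP->; rewrite !monomial0.
by move=> t /monomial_center ->; apply: Rmult_0_r.
Qed.

(** Some exponent is at least 1 and contributes a factor at most [rho]; all other factors are at
    most 1. *)
Lemma ffweight_le_rho rho al : 0 < rho <= 1 -> al != [ffun=> 0%nat] -> ffweight rho al <= rho.
Proof.
move=> [r0 r1] al0; have [i ali] := ffun_neq0 al0.
have pow_le1 k : 0 <= rho ^ k <= 1.
  by split; [apply: pow_le; lra | rewrite -(pow1 k); apply: pow_incr; lra].
rewrite /ffweight /Rprod (bigD1 i) //=.
rewrite -[X in _ <= X]Rmult_1_r; apply: Rmult_le_compat.
- by have := pow_le1 (al i); lra.
- apply: (big_ind (fun x => 0 <= x)); first lra; first by move=> *; exact: Rmult_le_pos.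
  by move=> j _; have := pow_le1 (al j); lra.
- case: (al i) ali => // k _ /=; have := pow_le1 k; nra.
- apply: (proj2 (A := 0 <= _)); apply: (big_ind (fun x => 0 <= x <= 1)); first lra.
    move=> a b ha hb; nra.
  by move=> j _; exact: pow_le1.
Qed.

Lemma ffnorm_le_rho rho P : 0 < rho <= 1 -> all (fun t => t.2 != [ffun=> 0%nat]) P ->
  ffnorm rho P <= rho * \big[Rplus/0]_(t <- P) Rabs t.1.
Proof.
move=> hr; rewrite /ffnorm; elim: P => [|t P IH] /=; first by rewrite !big_nil; lra.
move=> /andP[t0 /IH h]; rewrite !big_cons.
by have := ffweight_le_rho hr t0; have := Rabs_pos t.1; nra.
Qed.

Lemma ffnorm_small P (m : R) : all (fun t => t.2 != [ffun=> 0%nat]) P -> 0 < m ->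
  exists rho, 0 < rho /\ ffnorm rho P < m.
Proof.
move=> hP m0; pose S := \big[Rplus/0]_(t <- P) Rabs t.1.
have S0 : 0 <= S by apply: bigsum_ge0 => t _; exact: Rabs_pos.
(* Dividing by [S + 1] instead of [S] avoids a zero denominator and makes the bound strict:
   [rho * S < rho * (S + 1) <= m]. *)
pose rho := Rmin 1 (m / (S + 1)).
have q0 : 0 < m / (S + 1) by apply: Rdiv_lt_0_compat; lra.
have rho0 : 0 < rho by apply: Rmin_pos => //; lra.
have rho1 : rho <= 1 by exact: Rmin_l.
exists rho; split=> //.
have le_S : ffnorm rho P <= rho * S by apply: ffnorm_le_rho.
have h : rho * (S + 1) <= m.
  have <- : m / (S + 1) * (S + 1) = m by field; lra.
  by apply: Rmult_le_compat_r; [lra | exact: Rmin_r].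
lra.
Qed.

(** * Regrouping a series of polynomials into one power series *)

Definition in_box (N : nat) al : bool := [forall i, (al i <= N)%nat].

Definition ofbox N (b : {ffun I -> 'I_N.+1}) : {ffun I -> nat} := [ffun i => nat_of_ord (b i)].

(** An exponent in the box is named by exactly one index [b], any other exponent by none. *)
Lemma box_group N P (F : R * {ffun I -> nat} -> R) :
  Rsum (fun b : {ffun I -> 'I_N.+1} => \big[Rplus/0]_(t <- P | t.2 == ofbox b) F t) =
  \big[Rplus/0]_(t <- P | in_box N t.2) F t.
Proof.
rewrite /Rsum (exchange_big_dep predT) //= [RHS]big_mkcond.
apply: eq_bigr => t _; case: ifP => [/forallP tN|tN].
  rewrite (big_pred1 [ffun i => inord (t.2 i)]) // => b; apply/eqP/eqP => [->|->].
    by apply/ffunP => i; rewrite !ffunE inord_val.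
  by apply/ffunP => i; rewrite !ffunE inordK // ltnS.
rewrite big_pred0 // => b; apply/eqP => e; move/negP: tN; apply; apply/forallP => i.
by rewrite e ffunE -ltnS.
Qed.

Lemma monomial_ofbox N y p (b : {ffun I -> 'I_N.+1}) :
  monomial y p (fun i => nat_of_ord (b i)) = monomial y p (ofbox b).
Proof. by rewrite /monomial /Rprod; apply: eq_bigr => i _; rewrite ffunE. Qed.

(** A Cauchy-type estimate: dividing by the weight bounds each coefficient by the norm, so the
    coefficients of a fixed exponent along a norm-summable sequence of polynomials are summable. *)
Lemma ffcoef_le_norm rho P al : 0 < rho -> Rabs (ffcoef P al) * ffweight rho al <= ffnorm rho P.
Proof.
move=> r0; have w0 := @ffweight_gt0 rho al r0.
apply: Rle_trans (_ : \big[Rplus/0]_(t <- P | t.2 == al) (Rabs t.1 * ffweight rho t.2) <= _).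
  rewrite (eq_bigr (fun t => Rabs t.1 * ffweight rho al)); last by move=> t /eqP ->.
  rewrite -big_distrl /=; apply: Rmult_le_compat_r; first lra.
  by apply: Rabs_bigsum_le => t _; exact: Rle_refl.
apply: bigsum_sub_le => t; apply: Rmult_le_pos; first exact: Rabs_pos.
exact/Rlt_le/ffweight_gt0.
Qed.

Lemma big_box_stationary P (F : R * {ffun I -> nat} -> R) : exists N0, forall N, (N0 <= N)%nat ->
  \big[Rplus/0]_(t <- P | in_box N t.2) F t = \big[Rplus/0]_(t <- P) F t.
Proof.
elim: P => [|t P [N0 IH]]; first by exists 0%nat => N _; rewrite !big_nil.
exists (maxn N0 (\max_i t.2 i)) => N; rewrite geq_max => /andP[hN0 /bigmax_leqP ht].
rewrite !big_cons IH // ifT //; apply/forallP => i; exact: ht.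
Qed.

(* Collecting the monomials of all the [Q k] gives the power series: absolute
   convergence in the weighted norm makes the regrouping legitimate. *)
Lemma polyn_series_expansion (p : I -> R) (f : (I -> R) -> R) (rho : R)
    (Q : nat -> seq (R * {ffun I -> nat})) :
  0 < rho -> ex_series (fun k => ffnorm rho (Q k)) ->
  (forall y, Rsupdist y p < rho -> is_series (fun k => ffeval p (Q k) y) (f y)) ->
  exists c : (I -> nat) -> R, forall y, Rsupdist y p < rho ->
    Un_cv (fun N => box_partial N (fun (al : I -> nat) => c al * monomial y p al)) (f y) /\
    exists M, forall N, box_partial N (fun (al : I -> nat) => Rabs (c al * monomial y p al)) <= M.
Proof.
move=> r0 exQ hf.
pose co k (al : I -> nat) := ffcoef (Q k) [ffun i => al i].
have coW (al : I -> nat) : ffweight rho al = ffweight rho [ffun i => al i].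
  by rewrite /ffweight /Rprod; apply: eq_bigr => i _; rewrite ffunE.
have excoabs (al : I -> nat) : ex_series (fun k => Rabs (co k al)).
  have w0 := @ffweight_gt0 rho al r0.
  apply: (ex_series_le _ (fun k => / ffweight rho al * ffnorm rho (Q k))); last first.
    exact: (ex_series_scal (/ ffweight rho al)).
  move=> k; rewrite /norm /= /abs /= Rabs_Rabsolu.
  rewrite Rmult_comm; apply/Rle_div_r => //; rewrite coW; exact: ffcoef_le_norm.
have exco (al : I -> nat) := ex_series_Rabs _ (excoabs al).
(* The coefficient of [al] is the sum over [k] of its coefficients in the [Q k]. *)
exists (fun (al : I -> nat) => Series (co^~ al)) => y yp.
have ofb N (b : {ffun I -> 'I_N.+1}) : [ffun i => nat_of_ord (b i)] = ofbox b by [].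
split.
  (* Row [N] truncates each [Q k] to the box. Each [Q k] has finitely many exponents, so its
     truncations are eventually complete, and its norm dominates them all. *)
  pose F N k := \big[Rplus/0]_(t <- Q k | in_box N t.2) (t.1 * monomial y p t.2).
  apply: (series_dominated_cv (F := F) (b := fun k => ffnorm rho (Q k)) _ _ exQ _ _ (hf y yp)).
  - move=> N k; apply: Rle_trans (bigsum_sub_le _ _ _) => [|t].
      apply: Rabs_bigsum_le => t _; rewrite Rabs_mult.
      by apply: Rmult_le_compat_l; [exact: Rabs_pos | exact: monomial_le_weight].
    by apply: Rmult_le_pos; [exact: Rabs_pos | exact/Rlt_le/ffweight_gt0].
  - by move=> k; exact: ffeval_le_norm.
  - move=> k; have [N0 hN0] := big_box_stationary (Q k) (fun t => t.1 * monomial y p t.2).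
    by exists N0 => N /hN0.
  (* The box is finite, so the sum over it may be exchanged with the series over [k]. *)
  - move=> N; rewrite /box_partial /Rsum.
    pose cf (b : {ffun I -> 'I_N.+1}) k :=
      co k (fun i => nat_of_ord (b i)) * monomial y p (fun i => nat_of_ord (b i)).
    apply: (is_series_ext (fun k => \big[Rplus/0]_(b : {ffun I -> 'I_N.+1}) cf b k)); last first.
      by apply: is_series_bigsum => b; apply: is_series_scal_r; exact: Series_correct.
    move=> k.
    rewrite /F -box_group /Rsum; apply: eq_bigr => b _.
    rewrite /cf /co /ffcoef ofb big_distrl /=; apply: eq_bigr => t /eqP ->.
    by rewrite monomial_ofbox.
exists (Series (fun k => ffnorm rho (Q k))) => N.
(* Replacing monomials by their weights gives a bound independent of [N]: for each [k] the box sum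
   is at most the norm of [Q k]. *)
pose B (b : {ffun I -> 'I_N.+1}) k :=
  Rabs (co k (fun i => nat_of_ord (b i))) * ffweight rho (ofbox b).
pose A k := Rsum (B^~ k).
have A_le k : 0 <= A k <= ffnorm rho (Q k).
  split.
    apply: bigsum_ge0 => b _; apply: Rmult_le_pos; first exact: Rabs_pos.
    exact/Rlt_le/ffweight_gt0.
  apply: Rle_trans (_ : \big[Rplus/0]_(t <- Q k | in_box N t.2) (Rabs t.1 * ffweight rho t.2) <= _).
    rewrite -box_group /Rsum; apply: bigsum_le => b _; rewrite /B /co /ffcoef ofb.
    rewrite [X in _ <= X](eq_bigr (fun t => Rabs t.1 * ffweight rho (ofbox b)));
      last by move=> t /eqP ->.
    rewrite -big_distrl /=; apply: Rmult_le_compat_r; first exact/Rlt_le/ffweight_gt0.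
    by apply: Rabs_bigsum_le => t _; exact: Rle_refl.
  apply: bigsum_sub_le => t; apply: Rmult_le_pos; first exact: Rabs_pos.
  exact/Rlt_le/ffweight_gt0.
apply: Rle_trans (Series_le _ _ A_le exQ).
have isA : is_series A (Rsum (fun b : {ffun I -> 'I_N.+1} =>
    Series (fun k => Rabs (co k (fun i => nat_of_ord (b i)))) * ffweight rho (ofbox b))).
  by apply: (is_series_bigsum (F := B)) => b; apply: is_series_scal_r; exact: Series_correct.
rewrite (is_series_unique _ _ isA); apply: bigsum_le => b _.
rewrite Rabs_mult monomial_ofbox; apply: Rmult_le_compat; try exact: Rabs_pos.
  exact: Series_Rabs.
exact: monomial_le_weight.
Qed.

End Polynomials.

(** Substitute [P = q - q p], which has no constant term, into the series of [h]. The term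
    [a_k P^k S], with [S] a list for [F j], has norm [|a_k| |P|^k |S|], summable once the norm of
    [P] is below the radius for [h]. The separate bound [d] serves to keep [y] in a prescribed
    domain. *)
Lemma comp_polyn_expansion (I J : finType) (h : R -> R) (p : I -> R) (q : (I -> R) -> R)
    (F : J -> (I -> R) -> R) (d : R) :
  0 < d -> expands_at h (q p) -> is_polyn p q -> (forall j, is_polyn p (F j)) ->
  exists r, 0 < r /\ exists c : (I -> nat) -> J -> R, forall y, Rsupdist y p < r ->
    Rabs (q y - q p) < d /\ forall j,
      Un_cv (fun N => box_partial N (fun (al : I -> nat) => c al j * monomial y p al)) (h (q y) * F j y) /\
      exists M, forall N, box_partial N (fun (al : I -> nat) => Rabs (c al j * monomial y p al)) <= M.
Proof.
move=> d0 [a [d' [d'0 ha]]] hq hF.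
have [P [P0 qP]] : exists P, all (fun t => t.2 != [ffun=> 0%nat]) P /\ forall y, q y - q p = ffeval p P y.
  apply: is_polyn_vanishing; last by rewrite Rminus_diag.
  by apply: is_polyn_sub => //; exact: is_polyn_const.
have [r [r0 Pr]] := @ffnorm_small _ P (Rmin d d') P0 (Rmin_pos _ _ d0 d'0).
have [Pd Pd'] : ffnorm r P < d /\ ffnorm r P < d'.
  by have := Rmin_l d d'; have := Rmin_r d d'; lra.
have Pge := ffnorm_ge0 P r0.
have small y : Rsupdist y p < r -> Rabs (q y - q p) <= ffnorm r P.
  by move=> yp; rewrite qP; exact: ffeval_le_norm.
have exp j : exists c : (I -> nat) -> R, forall y, Rsupdist y p < r ->
    Un_cv (fun N => box_partial N (fun (al : I -> nat) => c al * monomial y p al)) (h (q y) * F j y) /\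
    exists M, forall N, box_partial N (fun (al : I -> nat) => Rabs (c al * monomial y p al)) <= M.
  have [S hS] := hF j.
  pose Q k := ffmul (ffmul (ffconst I (a k)) (ffpow P k)) S.
  apply: (polyn_series_expansion (Q := Q) r0).
    apply: (ex_series_ext (fun k => scal (ffnorm r S) (Rabs (a k * ffnorm r P ^ k)))).
      move=> k; rewrite /Q !ffnorm_mul ffnorm_const ffnorm_pow Rabs_mult.
      rewrite [Rabs (_ ^ k)]Rabs_pos_eq; last exact: pow_le.
      by rewrite /scal /= /mult /=; ring.
    apply: ex_series_scal; apply: CV_disk_inside.
    by apply: (pseries_disk_CV_radius ha); rewrite Rabs_pos_eq.
  move=> y yp.
  have sd : Rabs (q y - q p) < d' by have := small y yp; lra.
  have := is_series_scal_r (F j y) _ _ (proj1 (is_pseries_R _ _ _) (ha _ sd)).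
  rewrite Rplus_minus; apply: is_series_ext => k.
  by rewrite /Q !ffeval_mul ffeval_const ffeval_pow -hS -qP.
exists r; split=> //.
(* The radius [r] is common to all [j]; choice collects the coefficient families. *)
exists (fun al j => proj1_sig (constructive_indefinite_description _ (exp j)) al) => y yp.
split; first by have := small y yp; lra.
by move=> j; case: (constructive_indefinite_description _ (exp j)) => c hc /=; exact: hc.
Qed.

(** * The integral identity *)

Section Vectors.
Variable n : nat.
Implicit Types u v w : vec n.

Lemma dotvC u v : dotv u v = dotv v u.
Proof. by apply: eq_bigr => i _; apply: Rmult_comm. Qed.

Lemma dotv_scal_l (c : R) u v : dotv (fun i => c * u i) v = c * dotv u v.
Proof. by rewrite /dotv /Rsum big_distrr; apply: eq_bigr => i _; apply: Rmult_assoc. Qed.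

Lemma dotv_scal_r (c : R) u v : dotv u (fun i => c * v i) = c * dotv u v.
Proof. by rewrite dotvC dotv_scal_l dotvC. Qed.

Lemma dotv_sub_l u v w : dotv (subv u v) w = dotv u w - dotv v w.
Proof.
have -> : dotv v w = - dotv (fun i => -1 * v i) w by rewrite dotv_scal_l; ring.
rewrite /Rminus Ropp_involutive /dotv /Rsum -big_split /=.
by apply: eq_bigr => i _; rewrite /subv; ring.
Qed.

Lemma dotv_sub_r u v w : dotv w (subv u v) = dotv w u - dotv w v.
Proof. by rewrite dotvC dotv_sub_l !(dotvC w). Qed.

Lemma dotv_ge0 u : 0 <= dotv u u.
Proof. by apply: bigsum_ge0 => i _; exact: Rle_0_sqr. Qed.

Lemma dotv_eq0 u i : dotv u u = 0 -> u i = 0.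
Proof.
move=> u0; apply: Rsqr_0_uniq; apply: Rle_antisym; last exact: Rle_0_sqr.
rewrite -u0 /dotv /Rsum (bigD1 i) //= -[X in X <= _]Rplus_0_r.
apply: Rplus_le_compat_l; apply: bigsum_ge0 => j _; exact: Rle_0_sqr.
Qed.

Lemma perp_scal (t : vec n) (c : R) u i : perp t (fun k => c * u k) i = c * perp t u i.
Proof. by rewrite /perp dotv_scal_l; ring. Qed.

End Vectors.

(** * Riemann integrals and continuity *)

(** Integrability makes the [epsilon] choice meaningful, and every proof of integrability yields the
    same value. *)
Lemma Rint_unique (f : R -> R) (a b v : R) : is_RInt f a b v -> Rint f a b = v.
Proof.
move=> fv; have exf : ex_RInt f a b by exists v.
have [pr hpr] := epsilon_spec (inhabits 0)
  (fun v => exists pr : Riemann_integrable f a b, RiemannInt pr = v)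
  (ex_intro _ _ (ex_intro _ (ex_RInt_Reals_0 _ _ _ exf) erefl)).
by rewrite -(is_RInt_unique _ _ _ _ fv) (RInt_Reals _ _ _ pr) hpr.
Qed.

Lemma is_RInt_extR (f h : R -> R) (a b v : R) :
  (forall t, Rmin a b < t < Rmax a b -> f t = h t) -> is_RInt f a b v -> is_RInt h a b v.
Proof. exact: is_RInt_ext. Qed.
Arguments is_RInt_extR {f h a b v} _ _.

Lemma is_RInt_scalR (c : R) (f : R -> R) (a b v : R) :
  is_RInt f a b v -> is_RInt (fun t => c * f t) a b (c * v).
Proof. exact: is_RInt_scal. Qed.
Arguments is_RInt_scalR c {f a b v} _.

Lemma is_RInt_sub (f h : R -> R) (a b v z : R) :
  is_RInt f a b v -> is_RInt h a b z -> is_RInt (fun t => f t - h t) a b (v - z).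
Proof. exact: is_RInt_minus. Qed.

Lemma is_RInt_cst (c : R) : is_RInt (fun=> c) 0 1 c.
Proof.
have := is_RInt_const 0 1 c; rewrite /scal /= /mult /=.
by have -> : (1 - 0) * c = c by ring.
Qed.

Lemma is_RInt_Rsum (I : finType) (F : R -> I -> R) (a b : R) (V : I -> R) :
  (forall i, is_RInt (F^~ i) a b (V i)) -> is_RInt (fun t => Rsum (F t)) a b (Rsum V).
Proof.
move=> hF; rewrite /Rsum; elim: (index_enum I) => [|i s IH].
  rewrite big_nil; apply: (is_RInt_extR (f := fun=> 0)); first by move=> t _; rewrite big_nil.
  have := is_RInt_const a b (0 : R); rewrite /scal /= /mult /= Rmult_0_r; exact.
rewrite big_cons; apply: (is_RInt_extR (f := fun t => plus (F t i) (\big[Rplus/0]_(j <- s) F t j))).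
  by move=> t _; rewrite big_cons.
exact: (is_RInt_plus _ _ _ _ _ _ (hF i) IH).
Qed.

Lemma is_RInt_dotv_l (n : nat) (F : R -> vec n) (u V : vec n) (a b : R) :
  (forall k, is_RInt (fun t => F t k) a b (V k)) ->
  is_RInt (fun t => dotv (F t) u) a b (dotv V u).
Proof.
move=> hF; apply: (is_RInt_Rsum (F := fun t k => F t k * u k)) => k.
rewrite Rmult_comm; apply: (is_RInt_extR (f := fun t => u k * F t k)).
  by move=> t _; exact: Rmult_comm.
exact: is_RInt_scalR.
Qed.

Arguments is_RInt_dotv_l {n F} u {V a b} _.

Lemma is_RInt_dotv_r (n : nat) (F : R -> vec n) (u V : vec n) (a b : R) :
  (forall k, is_RInt (fun t => F t k) a b (V k)) ->
  is_RInt (fun t => dotv u (F t)) a b (dotv u V).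
Proof.
move=> hF; rewrite dotvC; apply: (is_RInt_extR (f := fun t => dotv (F t) u)).
  by move=> t _; exact: dotvC.
exact: is_RInt_dotv_l.
Qed.

(** Fundamental theorem of calculus along [s -> c + s m]. The case [m = 0] is included, as the
    diagonal [r1 = r2] demands. *)
Lemma is_RInt_derive_affine (f f' : R -> R) (c m : R) :
  (forall t, is_derive f t (f' t)) -> (forall t, continuous f' t) ->
  is_RInt (fun s => m * f' (c + s * m)) 0 1 (f (c + m) - f c).
Proof.
move=> df cf'.
have -> : f (c + m) - f c = minus (f (c + 1 * m)) (f (c + 0 * m)).
  by rewrite Rmult_1_l Rmult_0_l Rplus_0_r.
apply: (is_RInt_derive (fun s => f (c + s * m))) => s _.
  apply: is_derive_comp; first exact: df.
  by auto_derive => //; ring.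
apply: continuous_mult; first exact: continuous_const.
apply: continuous_comp; last exact: cf'.
by apply: (@ex_derive_continuous R_AbsRing R_NormedModule); auto_derive.
Qed.

Lemma continuous_Rsum (I : finType) (F : R -> I -> R) (t : R) :
  (forall i, continuous (F^~ i) t) -> continuous (fun s => Rsum (F s)) t.
Proof.
move=> hF; rewrite /Rsum; elim: (index_enum I) => [|i s IH].
  apply: (continuous_ext (fun=> 0)); first by move=> u; rewrite big_nil.
  exact: continuous_const.
apply: (continuous_ext (fun u => plus (F u i) (\big[Rplus/0]_(j <- s) F u j))).
  by move=> u; rewrite big_cons.
exact: continuous_plus (hF i) IH.
Qed.

Lemma continuous_inv_Rpower (f : R -> R) (b t : R) :
  continuous f t -> 0 < f t -> continuous (fun s => / Rpower (f s) b) t.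
Proof.
move=> cf ft; apply: (continuous_comp f (fun z => / Rpower z b)) => //.
apply: (@ex_derive_continuous R_AbsRing R_NormedModule).
have ne : exp (b * ln (f t)) <> 0 by apply: Rgt_not_eq; exact: exp_pos.
by rewrite /Rpower; auto_derive.
Qed.

(* The kernel [g] of the paper as a function of [q = |a|^2], without the factor [1/2]. *)
Definition kernel (alpha q : R) : R := (Rpower q (- ((alpha + 2) / 2)) - 1) * / (1 - q).

Definition G1 (n : nat) (alpha : R) (a b c d e : vec n) : vec n :=
  fun j => kernel alpha (dotv a a) * (/ 2 * dotv c d * perp b e j).

(** At [q = 1] both sides are 0, whatever value the inverse of 0 takes. Hence chords with [|a| = 1],
    outside the domain of analyticity, need no separate treatment in the integral identity. *)
Lemma kernel_mul (alpha q : R) :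
  kernel alpha q * (1 - q) = Rpower q (- ((alpha + 2) / 2)) - 1.
Proof.
rewrite /kernel; have [->|q1] := Req_dec q 1; last by field; lra.
by rewrite {2}/Rpower ln_1 Rmult_0_r exp_0; ring.
Qed.

Lemma G1_analytic (n : nat) (alpha : R) : -2 < alpha -> analytic5 (@G1 n alpha).
Proof.
move=> al2 p [p0 p1].
pose q (y : 'I_5 * 'I_n -> R) := dotv (blk y 0) (blk y 0).
pose F (j : 'I_n) (y : 'I_5 * 'I_n -> R) :=
  / 2 * dotv (blk y 2) (blk y 3) * perp (blk y 1) (blk y 4) j.
have q0 : 0 < q p.
  have := dotv_ge0 (blk p 0) => /Rle_lt_or_eq_dec [//|e].
  by case: p0; rewrite /normv -e sqrt_0.
have q1 : q p <> 1 by move=> e; case: p1; rewrite /normv -/(q p) e sqrt_1.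
(* The bound on [alpha] makes the exponent negative, as the binomial series requires. *)
have ex_h : expands_at (kernel alpha) (q p).
  apply: expands_at_mul; last exact: expands_at_inv_sub.
  by apply: expands_at_sub_const; apply: expands_at_Rpower => //; lra.
have dot_polyn k l : is_polyn p (fun y => dotv (blk y k) (blk y l)).
  apply: (is_polyn_Rsum (F := fun i y => blk y k i * blk y l i)) => i.
  by apply: is_polyn_mul; exact: is_polyn_coord.
have F_polyn j : is_polyn p (F j).
  apply: is_polyn_mul; first by apply: is_polyn_mul => //; exact: is_polyn_const.
  apply: is_polyn_sub; first exact: is_polyn_coord.
  by apply: is_polyn_mul => //; exact: is_polyn_coord.
(* Within this distance of [q p] the value [q y] stays positive and different from 1, so [y] stays
   in the domain. *)
have d0 : 0 < Rmin (q p) (Rabs (q p - 1)).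
  by apply: Rmin_pos => //; apply: Rabs_pos_lt; lra.
have [r [r0 [c hc]]] := comp_polyn_expansion d0 ex_h (dot_polyn 0%nat 0%nat) F_polyn.
exists r; split=> //; exists c => y yp; have [near series] := hc y yp.
split; last exact: series.
have near0 := Rlt_le_trans _ _ _ near (Rmin_l _ _).
have near1 := Rlt_le_trans _ _ _ near (Rmin_r _ _).
rewrite -/(q y) in near0 near1.
have qy0 : 0 < q y by move: near0 => /Rabs_def2; lra.
split; rewrite /normv -/(q y); first by have := sqrt_lt_R0 _ qy0; lra.
move=> e; have qy1 : q y = 1 by rewrite -(sqrt_sqrt (q y)) ?e; lra.
by rewrite qy1 -Rabs_Ropp Ropp_minus_distr in near1; lra.
Qed.

(** * Increments of a unit-speed curve *)

Section Curve.
Variables (n : nat) (g : R -> vec n) (Dg : nat -> R -> vec n).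
Hypothesis g_smooth : smooth_closed_curve g Dg.
Hypothesis g_arclength : arclength_param Dg.

Lemma curve_derive (m : nat) (t : R) (i : 'I_n) :
  is_derive (fun s => Dg m s i) t (Dg m.+1 t i).
Proof. by apply/is_derive_Reals; case: g_smooth => _ []. Qed.

Lemma curve_continuous (m : nat) (t : R) (i : 'I_n) : continuous (fun s => Dg m s i) t.
Proof.
apply: (@ex_derive_continuous R_AbsRing R_NormedModule).
by exists (Dg m.+1 t i); exact: curve_derive.
Qed.

Lemma curve_eq : Dg 0%nat = g.
Proof. by case: g_smooth. Qed.

Lemma tangent_unit (t : R) : dotv (Dg 1%nat t) (Dg 1%nat t) = 1.
Proof.
have := g_arclength t; rewrite /normv => e.
by rewrite -(sqrt_sqrt _ (dotv_ge0 _)) e; ring.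
Qed.

Section Increment.
Variables (x w : R).
Hypothesis w0 : w <> 0.

(** [chord] and [taylor2] are closed forms of the arguments [a] and [e] of [G1]; the next two lemmas
    identify them with the averages. *)
Definition chord : vec n := fun k => (g (x + w) k - g x k) / w.

Definition taylor2 : vec n := fun k => (g (x + w) k - g x k - w * Dg 1%nat x k) / w ^ 2.

Lemma is_RInt_chord k : is_RInt (fun s => Dg 1%nat (x + s * w) k) 0 1 (chord k).
Proof.
have := is_RInt_derive_affine (c := x) (m := w)
  (fun t => @curve_derive 0%nat t k) (fun t => @curve_continuous 1%nat t k).
move/(is_RInt_scalR (/ w)); rewrite curve_eq.
have -> : / w * (g (x + w) k - g x k) = chord k by rewrite /chord; field.
by apply: is_RInt_extR => s _; field.
Qed.

Lemma is_RInt_taylor2 k :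
  is_RInt (fun t => Dg 2%nat (x + t * w) k * (1 - t)) 0 1 (taylor2 k).
Proof.
(* Antiderivative from integration by parts: differentiating [1 - t] gives [- g' / w], which cancels
   the derivative of [g / w^2]. *)
pose A t := (1 - t) * (/ w * Dg 1%nat (x + t * w) k) + / w ^ 2 * Dg 0%nat (x + t * w) k.
have -> : taylor2 k = minus (A 1) (A 0).
  rewrite /taylor2 /A /minus /plus /opp /= !Rmult_0_l !Rplus_0_r !Rmult_1_l curve_eq.
  by field.
have dm m t : is_derive (fun s => Dg m (x + s * w) k) t (w * Dg m.+1 (x + t * w) k).
  apply: (is_derive_comp (fun u => Dg m u k)); first exact: curve_derive.
  by auto_derive => //; ring.
have dA (u v : R -> R) (t du dv : R) : is_derive u t du -> is_derive v t dv ->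
    is_derive (fun s => (1 - s) * (/ w * u s) + / w ^ 2 * v s) t
      (- (/ w * u t) + (1 - t) * (/ w * du) + / w ^ 2 * dv).
  move=> hu hv; auto_derive; first by do !split; [exists du | exists dv].
  rewrite (is_derive_unique _ _ _ hu) (is_derive_unique _ _ _ hv); by field.
apply: (is_RInt_derive A (fun t => Dg 2%nat (x + t * w) k * (1 - t))) => t _.
  have := dA _ _ _ _ _ (dm 1%nat t) (dm 0%nat t).
  set l := (X in is_derive _ _ X -> _).
  have -> // : l = Dg 2%nat (x + t * w) k * (1 - t) by rewrite /l; field.
apply: continuous_mult.
  apply: (continuous_comp (fun s => x + s * w) (fun u => Dg 2%nat u k)); last exact: curve_continuous.
  by apply: (@ex_derive_continuous R_AbsRing R_NormedModule); auto_derive.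
by apply: (@ex_derive_continuous R_AbsRing R_NormedModule); auto_derive.
Qed.

Definition diffquot (r1 r2 : R) : vec n :=
  fun k => / w * (Dg 1%nat (x + r1 * w) k - Dg 1%nat (x + r2 * w) k).

Definition curv (r1 r2 psi : R) : vec n := Dg 2%nat (x + r2 * w + (r1 - r2) * psi * w).

Lemma is_RInt_diffquot r1 r2 k :
  is_RInt (fun psi => (r1 - r2) * curv r1 r2 psi k) 0 1 (diffquot r1 r2 k).
Proof.
have := is_RInt_derive_affine (c := x + r2 * w) (m := (r1 - r2) * w)
  (fun t => @curve_derive 1%nat t k) (fun t => @curve_continuous 2%nat t k).
move/(is_RInt_scalR (/ w)); rewrite /diffquot.
have -> : x + r2 * w + (r1 - r2) * w = x + r1 * w by ring.
apply: is_RInt_extR => s _; rewrite /curv.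
have -> : x + r2 * w + s * ((r1 - r2) * w) = x + r2 * w + (r1 - r2) * s * w by ring.
by field.
Qed.

(** Expand the square; unit speed turns both diagonal terms into 1. *)
Lemma dotv_diffquot r1 r2 : dotv (diffquot r1 r2) (diffquot r1 r2) =
  / w ^ 2 * (2 - 2 * dotv (Dg 1%nat (x + r1 * w)) (Dg 1%nat (x + r2 * w))).
Proof.
rewrite /diffquot dotv_scal_l dotv_scal_r !(dotv_sub_l, dotv_sub_r) !tangent_unit.
by rewrite (dotvC (Dg 1%nat (x + r2 * w))); field.
Qed.

(* Since [|gamma'| = 1], [1 - |chord|^2] is half the average over [r1], [r2] of
   [|gamma'(x + r1 w) - gamma'(x + r2 w)|^2]. *)
Lemma fourfold_integral (K v : R) :
  Rint (fun r2 => Rint (fun r1 => Rint (fun psi2 => Rint (fun psi1 =>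
    (r1 - r2) ^ 2 * (K * (/ 2 * dotv (curv r1 r2 psi1) (curv r1 r2 psi2) * v)))
    0 1) 0 1) 0 1) 0 1 = K * v * (1 - dotv chord chord) / w ^ 2.
Proof.
(* Each curvature vector takes one factor [r1 - r2]; averaging over [psi1] turns the first into
   [diffquot]. *)
have I1 r1 r2 psi2 : Rint (fun psi1 =>
    (r1 - r2) ^ 2 * (K * (/ 2 * dotv (curv r1 r2 psi1) (curv r1 r2 psi2) * v))) 0 1 =
    K * v / 2 * dotv (diffquot r1 r2) (fun k => (r1 - r2) * curv r1 r2 psi2 k).
  apply: Rint_unique.
  have := is_RInt_dotv_l (fun k => (r1 - r2) * curv r1 r2 psi2 k) (fun k => @is_RInt_diffquot r1 r2 k).
  move/(is_RInt_scalR (K * v / 2)); apply: is_RInt_extR.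
  by move=> psi1 _; rewrite dotv_scal_l dotv_scal_r; field.
(* Averaging over [psi2] does the same to the second, leaving the squared norm of [diffquot]. *)
have I2 r1 r2 : Rint (fun psi2 => Rint (fun psi1 =>
    (r1 - r2) ^ 2 * (K * (/ 2 * dotv (curv r1 r2 psi1) (curv r1 r2 psi2) * v))) 0 1) 0 1 =
    K * v / w ^ 2 * (1 - dotv (Dg 1%nat (x + r1 * w)) (Dg 1%nat (x + r2 * w))).
  rewrite (functional_extensionality _ _ (I1 r1 r2)); apply: Rint_unique.
  have -> : K * v / w ^ 2 * (1 - dotv (Dg 1%nat (x + r1 * w)) (Dg 1%nat (x + r2 * w))) =
      K * v / 2 * dotv (diffquot r1 r2) (diffquot r1 r2) by rewrite dotv_diffquot; field.
  by apply: is_RInt_scalR; apply: is_RInt_dotv_r; exact: is_RInt_diffquot.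
(* Averaging the tangent over [r1] gives the chord; the final integral in [r2] does so again. *)
have I3 r2 : Rint (fun r1 => Rint (fun psi2 => Rint (fun psi1 =>
    (r1 - r2) ^ 2 * (K * (/ 2 * dotv (curv r1 r2 psi1) (curv r1 r2 psi2) * v))) 0 1) 0 1) 0 1 =
    K * v / w ^ 2 * (1 - dotv chord (Dg 1%nat (x + r2 * w))).
  rewrite (functional_extensionality _ _ (I2^~ r2)); apply: Rint_unique.
  apply: is_RInt_scalR; apply: is_RInt_sub; first exact: is_RInt_cst.
  by apply: is_RInt_dotv_l; exact: is_RInt_chord.
have -> : K * v * (1 - dotv chord chord) / w ^ 2 = K * v / w ^ 2 * (1 - dotv chord chord).
  by field.
rewrite (functional_extensionality _ _ I3); apply: Rint_unique.
apply: is_RInt_scalR; apply: is_RInt_sub; first exact: is_RInt_cst.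
by apply: is_RInt_dotv_r; exact: is_RInt_chord.
Qed.

(** The squared chord length is [w^2 q], so [|w|^(-alpha-2)] factors out of the kernel difference
    and leaves [q^(-(alpha+2)/2) - 1], that is [kernel] times [1 - q]. The Taylor remainder brings
    [w^2], and [|w|^(alpha+2) = w^4 |w|^(alpha-2)] accounts for the rest. *)
Lemma integrand_eq (alpha : R) (i : 'I_n) : 0 < dotv chord chord ->
  perp (Dg 1%nat x) (fun k => (g (x + w) k - g x k - w * Dg 1%nat x k) *
    (/ Rpower (normv (subv (g (x + w)) (g x))) (alpha + 2) - / Rpower (Rabs w) (alpha + 2))) i =
  kernel alpha (dotv chord chord) * perp (Dg 1%nat x) taylor2 i *
    (1 - dotv chord chord) / w ^ 2 / Rpower (Rabs w) (alpha - 2).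
Proof.
move=> q0; set q := dotv chord chord in q0 *.
have aw0 : 0 < Rabs w by exact: Rabs_pos_lt.
have w2 : w ^ 2 = Rpower (Rabs w) 2.
  have -> : Rpower (Rabs w) 2 = Rabs w ^ 2.
    by rewrite -Rpower_pow //; congr Rpower; rewrite /INR; ring.
  by rewrite RPow_abs Rabs_pos_eq //; nra.
have norm_eq : normv (subv (g (x + w)) (g x)) = sqrt (w ^ 2 * q).
  rewrite /normv; congr sqrt.
  have -> : subv (g (x + w)) (g x) = (fun k => w * chord k).
    by apply: functional_extensionality => k; rewrite /subv /chord; field.
  by rewrite dotv_scal_l dotv_scal_r -/q; ring.
have inv_norm : / Rpower (normv (subv (g (x + w)) (g x))) (alpha + 2) =
    / Rpower (Rabs w) (alpha + 2) * Rpower q (- ((alpha + 2) / 2)).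
  have w2pos : 0 < w ^ 2 by nra.
  rewrite norm_eq -Rpower_sqrt; last exact: Rmult_lt_0_compat.
  rewrite Rpower_mult -!Rpower_Ropp -Rpower_mult_distr // w2 Rpower_mult.
  by congr (Rpower _ _ * Rpower _ _); field.
rewrite inv_norm.
have -> : (fun k => (g (x + w) k - g x k - w * Dg 1%nat x k) *
    (/ Rpower (Rabs w) (alpha + 2) * Rpower q (- ((alpha + 2) / 2)) -
     / Rpower (Rabs w) (alpha + 2))) =
  (fun k => w ^ 2 * / Rpower (Rabs w) (alpha + 2) * (Rpower q (- ((alpha + 2) / 2)) - 1) * taylor2 k).
  apply: functional_extensionality => k; rewrite /taylor2; field; split=> //.
  by apply: Rgt_not_eq; exact: exp_pos.
rewrite perp_scal -kernel_mul.
have -> : Rpower (Rabs w) (alpha + 2) = w ^ 2 * w ^ 2 * Rpower (Rabs w) (alpha - 2).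
  by rewrite w2 -!Rpower_plus; congr Rpower; ring.
have := exp_pos ((alpha - 2) * ln (Rabs w)); rewrite -/(Rpower (Rabs w) (alpha - 2)) => P0.
by field; split=> //; lra.
Qed.

End Increment.

(** Away from [w = 0] and from vanishing chords the powers have positive bases. Continuity supplies
    the integrability that lets the projection pass under the integral. *)
Lemma continuous_R1_integrand (alpha x w : R) (k : 'I_n) :
  w <> 0 -> 0 < dotv (subv (g (x + w)) (g x)) (subv (g (x + w)) (g x)) ->
  continuous (fun w => (g (x + w) k - g x k - w * Dg 1%nat x k) *
    (/ Rpower (normv (subv (g (x + w)) (g x))) (alpha + 2) - / Rpower (Rabs w) (alpha + 2))) w.
Proof.
move=> w0 q0.
have cg i : continuous (fun s => g (x + s) i - g x i) w.
  apply: continuous_minus; last exact: continuous_const.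
  rewrite -curve_eq; apply: (continuous_comp (fun s => x + s) (fun u => Dg 0%nat u i)).
    by apply: (@ex_derive_continuous R_AbsRing R_NormedModule); auto_derive.
  exact: curve_continuous.
apply: continuous_mult.
  apply: continuous_minus; first exact: cg.
  by apply: (@ex_derive_continuous R_AbsRing R_NormedModule); auto_derive.
apply: continuous_minus; apply: continuous_inv_Rpower.
- apply: (continuous_comp _ sqrt); last exact: continuous_sqrt.
  apply: (continuous_Rsum (F := fun s i => (g (x + s) i - g x i) * (g (x + s) i - g x i))).
  by move=> i; exact: continuous_mult.
- exact: sqrt_lt_R0.
- exact: continuous_Rabs.
- exact: Rabs_pos_lt.
Qed.

End Curve.

(** A vanishing chord makes [w] an integer by simplicity, and the only integer with [|w| < 1] is
    0. *)
Lemma simple_curve_chord (n : nat) (g : R -> vec n) (x w : R) :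
  simple_curve g -> w <> 0 -> Rabs w < 1 ->
  0 < dotv (subv (g (x + w)) (g x)) (subv (g (x + w)) (g x)).
Proof.
move=> simple w0 w1; have [//|e] := Rle_lt_or_eq_dec _ _ (dotv_ge0 (subv (g (x + w)) (g x))).
have gg : g x = g (x + w).
  apply: functional_extensionality => i.
  by have := dotv_eq0 i (esym e); rewrite /subv; lra.
have [z hz] := simple _ _ gg; have {}hz : w = IZR z by lra.
move: w1 w0; rewrite hz -abs_IZR => /lt_IZR z1 z0.
by case: z0; congr IZR; lia.
Qed.

(** The projection is linear with [t] fixed, so it commutes with integrals of integrable components.
    Integrability of [h] follows from the pointwise identity and need not be assumed. *)
Lemma perp_Wint (n : nat) (t : vec n) (f : R -> vec n) (h : R -> R) (eps : R) (i : 'I_n) :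
  0 < eps <= 1/2 ->
  (forall w, eps <= Rabs w <= 1/2 -> forall k, continuous (fun s => f s k) w) ->
  (forall w, eps <= Rabs w <= 1/2 -> perp t (f w) i = h w) ->
  perp t (Wint f eps) i = Rint h (- (1/2)) (- eps) + Rint h eps (1/2).
Proof.
move=> eps_bd cf fh.
have half a b : (forall w, Rmin a b <= w <= Rmax a b -> eps <= Rabs w <= 1/2) ->
    exists V : vec n, (forall k, Rint (fun w => f w k) a b = V k) /\ Rint h a b = perp t V i.
  move=> hab; exists (fun k => RInt (fun w => f w k) a b).
  have fV k : is_RInt (fun w => f w k) a b (RInt (fun w => f w k) a b).
    apply: RInt_correct; apply: (@ex_RInt_continuous R_CompleteNormedModule) => w hw.
    by apply: cf; exact: hab.
  split; first by move=> k; apply: Rint_unique.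
  apply: Rint_unique; apply: (is_RInt_extR (f := fun w => perp t (f w) i)).
    by move=> w hw; apply: fh; apply: hab; lra.
  rewrite /perp; apply: is_RInt_sub; first exact: fV.
  rewrite Rmult_comm; apply: (is_RInt_extR (f := fun w => t i * dotv (f w) t)).
    by move=> w _; exact: Rmult_comm.
  by apply: is_RInt_scalR; apply: is_RInt_dotv_l.
have [|V1 [e1 h1]] := half (- (1/2)) (- eps).
  by move=> w; rewrite Rmin_left ?Rmax_right; [move=> hw; rewrite Rabs_left | |]; lra.
have [|V2 [e2 h2]] := half eps (1/2).
  by move=> w; rewrite Rmin_left ?Rmax_right; [move=> hw; rewrite Rabs_pos_eq | |]; lra.
have -> : Wint f eps = (fun k => V1 k + V2 k).
  by apply: functional_extensionality => k; rewrite /Wint e1 e2.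
rewrite h1 h2 /perp.
have -> : dotv (fun k => V1 k + V2 k) t = dotv V1 t + dotv V2 t; last ring.
by rewrite /dotv /Rsum -big_split /=; apply: eq_bigr => k _; ring.
Qed.

Theorem theorem6p2 (n : nat) (alpha : R) :
  2 < alpha < 3 ->
  exists G : vec n -> vec n -> vec n -> vec n -> vec n -> vec n,
    analytic5 G /\
    forall (eps : R) (g : R -> vec n) (Dg : nat -> R -> vec n),
      0 < eps <= 1/2 ->
      smooth_closed_curve g Dg ->
      simple_curve g ->
      arclength_param Dg ->
      forall (x : R) (i : 'I_n),
        perp (Dg 1%nat x) (R1op alpha eps g (Dg 1%nat) x) i =
        RHS62 G alpha eps (Dg 1%nat) (Dg 2%nat) x i.
Proof.
move=> alpha_bd; exists (G1 alpha); split; first by apply: G1_analytic; lra.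
move=> eps g Dg eps_bd smooth simple arclen x i.
have w_bd w : eps <= Rabs w <= 1/2 ->
    w <> 0 /\ 0 < dotv (subv (g (x + w)) (g x)) (subv (g (x + w)) (g x)).
  move=> hw; have w0 : w <> 0 by move=> e; rewrite e Rabs_R0 in hw; lra.
  by split=> //; apply: simple_curve_chord => //; lra.
(* It remains to prove continuity of the left integrand and equality of the integrands at each
   [w]. *)
apply: perp_Wint => // w /w_bd[w0 q0].
  by move=> k; exact: (continuous_R1_integrand smooth).
have chord_eq : Vint (fun s => Dg 1%nat (x + s * w)) 0 1 = chord g x w.
  by apply: functional_extensionality => k; apply: Rint_unique; exact: (is_RInt_chord smooth).
have taylor_eq : Vint (fun t j' => Dg 2%nat (x + t * w) j' * (1 - t)) 0 1 = taylor2 g Dg x w.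
  by apply: functional_extensionality => k; apply: Rint_unique; exact: (is_RInt_taylor2 smooth).
rewrite integrand_eq //; last first.
  have -> : chord g x w = (fun k => / w * subv (g (x + w)) (g x) k).
    by apply: functional_extensionality => k; rewrite /chord /subv; exact: Rmult_comm.
  rewrite dotv_scal_l dotv_scal_r -Rmult_assoc; apply: Rmult_lt_0_compat => //.
  by rewrite -Rinv_mult; apply: Rinv_0_lt_compat; nra.
(* The kernel value and the projected remainder are constant in the four averaging variables; they
   serve as [K] and [v]. *)
congr (_ / _); rewrite -(fourfold_integral smooth arclen x w0).
by rewrite chord_eq taylor_eq /Vint /G1 /curv.
Qed.
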